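(* Let $S\subset\mathbb{P}^3$ be a smooth cubic surface over a field $K$. Suppose $P_0 \in S(K)$ is $K$-ternary. Let $B\subseteq S(K)$ be such that $\mathrm{Span}(B)=S(K)$. Then the set $\{[P-P_0] : P \in B \}$ generates $H^0_S(K)$. In particular, for any prime $p$, \[ r(S,K) \geq \dim_{\mathbb{F}_p} H^0_S(K)/p H^0_S(K). \]
   Context: A $K$-line is a line $\ell \subset \mathbb{P}^3$ defined over $K$. If $\ell \not\subset S$ is a $K$-line, then $\ell\cdot S = P+Q+R$ denotes the intersection of $\ell$ with $S$ counted with multiplicity. A line $\ell$ defined over $\overline{K}$ is an asymptotic line to $S$ at $P\in S(\overline{K})$ if it passes through $P$ and $(\ell\cdot S)_P\ge 3$; that is, either $\ell\not\subset S$ and $\ell$ meets $S$ at $P$ with multiplicity $3$, or $P\in\ell\subset S$. A point $P\in S(K)$ is $K$-ternary if at least one of the asymptotic lines to $S$ at $P$ is defined over $K$. Span and $r(S,K)$: For $B \subseteq S(K)$ define $B=B_0\subseteq B_1\subseteq B_2 \subseteq\cdots\subseteq S(K)$, where $B_{n+1}$ is the set of $R\in S(K)$ such that either $R\in B_n$, or for some $K$-line $\ell\not\subset S$ we have $\ell\cdot S=P+Q+R$ with $P,Q\in B_n$ (with $P=Q$ allowed). Then $\mathrm{Span}(B)=\bigcup_n B_n$, and $r(S,K)=\min\{\#B : B\subseteq S(K),\ \mathrm{Span}(B)=S(K)\}$ (possibly infinite). The group $H_S(K)$: Let $G_S(K)=\bigoplus_{P\in S(K)}\mathbb{Z}\cdot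 P$ be the free abelian group on $S(K)$. Let $G'_S(K)$ be the subgroup generated by all sums $P+Q+R$ with $P,Q,R\in S(K)$ (not necessarily distinct) such that (i) there is a $K$-line $\ell$ not contained in $S$ with $\ell\cdot S=P+Q+R$, or (ii) there is a $K$-line $\ell$ contained in $S$ with $P,Q,R\in\ell$. Let $\deg:G_S(K)\to\mathbb{Z}$, $\deg(\sum a_iP_i)=\sum a_i$, let $G''_S(K)=\{D\in G'_S(K):\deg(D)=0\}$, and $H_S(K)=G_S(K)/G''_S(K)$. The image of $D\in G_S(K)$ in $H_S(K)$ is denoted $[D]$. The degree map descends to $\deg:H_S(K)\to\mathbb{Z}$, and $H^0_S(K)=\{D\in H_S(K):\deg(D)=0\}$. *)

(* Defs.v *)
From HB Require Import structures.
From mathcomp Require Import all_boot all_order all_algebra.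
From mathcomp Require Import generic_quotient ring_quotient.
From mathcomp Require Import mathcomp_extra boolp classical_sets functions.
From mathcomp Require Import cardinality.
From mathcomp Require Import freeg mpoly.

Set Implicit Arguments.
Unset Strict Implicit.
Unset Printing Implicit Defensive.

Import GRing.Theory.
Local Open Scope classical_set_scope.
Local Open Scope card_scope.
Local Open Scope quotient_scope.
Local Open Scope ring_scope.

(* Points and lines of P^3 over a field L are the subspaces of L^4 of
   dimension 1 and 2; incidence is inclusion of subspaces. *)
Section Geometry.
Variable L : fieldType.
Implicit Types (G : {mpoly L[4]}) (X l : {vspace 'rV[L]_4}).

(* G is meant to be homogeneous, so that the choice of the nonzero vector
   [vpick X] of the point X is immaterial. *)
Definition on_surface G X : bool := G.@[(vpick X) 0] == 0.

(* Over an algebraically closed L this is inclusion of varieties. *)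
Definition line_in_surface G l : Prop := forall v, v \in l -> G.@[v 0] = 0.

(* The one-variable polynomial G(p + T q). *)
Definition line_restriction G (p q : 'rV[L]_4) : {poly L} :=
  mmap (@polyC L) (fun i => (p 0 i)%:P + q 0 i *: 'X) G.

(* For X on the line l, choose p with X = <p> and q with l = <p, q>: the
   multiplicity is the order of vanishing of G(p + T q) at T = 0, which does
   not depend on p and q. It is meaningful only when l is not contained in the
   surface. *)
Definition intersection_mult G l X : nat :=
  if (X <= l)%VS
  then mup 0 (line_restriction G (vpick X) (vpick (l :\: X)%VS)) else 0%N.

Definition asymptotic_line G l X : Prop :=
  [/\ \dim l = 2%N, (X <= l)%VS &
      line_in_surface G l \/ (3 <= intersection_mult G l X)%N].

End Geometry.

Section Surface.
Variables (K : fieldType) (Kbar : closedFieldType) (iota : {rmorphism K -> Kbar}).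
Implicit Types (U l : {vspace 'rV[K]_4}).

Definition base_change U : {vspace 'rV[Kbar]_4} :=
  <<[seq map_mx iota v | v <- vbasis U]>>%VS.

Variable F : {mpoly K[4]}.

Definition Fbar : {mpoly Kbar[4]} := map_mpoly iota F.

(* The vanishing of F itself is required since Euler's relation does not yield
   it in characteristic 3. *)
Definition smooth_surface : Prop :=
  forall v : 'rV[Kbar]_4, v != 0 ->
    ~ (Fbar.@[v 0] = 0 /\ forall i : 'I_4, (Fbar^`M(i)).@[v 0] = 0).

Definition rational_points : Type :=
  {X : {vspace 'rV[K]_4} | (\dim X == 1%N) && on_surface F X}.

HB.instance Definition _ := Choice.on rational_points.

Implicit Types (P Q R : rational_points) (B : set rational_points).

(* The containment is geometric: over a small finite field, a K-line may have
   all its K-points on S without lying in S. *)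
Definition Kline_in_surface l : Prop := line_in_surface Fbar (base_change l).

(* l is not contained in S and l.S = P + Q + R as 0-cycles over Kbar. *)
Definition line_meets_at l P Q R : Prop :=
  ~ Kline_in_surface l /\
  forall X : {vspace 'rV[Kbar]_4}, \dim X = 1%N ->
    intersection_mult Fbar (base_change l) X =
      ((X == base_change (val P)) + (X == base_change (val Q))
       + (X == base_change (val R)))%N.

Definition K_ternary P : Prop :=
  exists2 m : {vspace 'rV[Kbar]_4},
    asymptotic_line Fbar m (base_change (val P)) &
    exists2 l : {vspace 'rV[K]_4}, \dim l = 2%N & m = base_change l.

Definition span_step B : set rational_points :=
  [set R | B R \/ exists P Q l,
     [/\ B P, B Q, \dim l = 2%N & line_meets_at l P Q R]].

Definition Span B : set rational_points :=
  \bigcup_n iter n span_step B.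

End Surface.

(* Cardinals, possibly infinite, are represented by sets and compared by
   [#<=]; the next lemma makes minima of cardinals well defined. *)
Lemma exists_min_card (T : Type) (C : set (set T)) : C !=set0 ->
  exists2 A, C A & forall A', C A' -> A #<= A'.
Proof.
move=> [C0 CC0].
have [/existsNP[A /not_implyP[CA A0]]|] :=
  pselect (~ forall A, C A -> A !=set0).
  exists A => // A' _; have -> : A = set0 by apply: contra_notP A0 => /eqP/set0P.
  exact: card_ge0.
move=> /contrapT Cn0.
pose P (M : set (set T -> T)) :=
  (forall f, M f -> forall A, C A -> A (f A)) /\
  (forall f g, M f -> M g -> forall A, C A -> f A = g A -> f = g).
have [|M [[M1 M2] Mmax]] := @Zorn_bigcup _ P.
  move=> Fs FsP tot; split.
    by move=> f [X FX Xf]; exact: (FsP _ FX).1.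
  move=> f g [X FX Xf] [Y FY Yg] A CA fg.
  have [XY|YX] := tot _ _ FX FY.
    by apply: (FsP _ FY).2 fg => //; exact: XY.
  by apply: (FsP _ FX).2 fg => //; exact: YX.
have [A CA sA] : exists2 A, C A & forall a, A a -> exists2 f, M f & f A = a.
  apply: contrapT => nA.
  have ex A : C A -> exists2 a, A a & forall f, M f -> f A <> a.
    move=> CA; apply: contrapT => na; apply: nA; exists A => // a Aa.
    apply: contrapT => nf; apply: na; exists a => // f Mf fA.
    by apply: nf; exists f.
  have [t0 _] := Cn0 _ CC0.
  have exg A : exists a, C A -> A a /\ forall f, M f -> f A <> a.
    have [CA|nCA] := pselect (C A); last by exists t0.
    by have [a Aa Ha] := ex A CA; exists a.
  have [g Hg] := choice exg.
  have nMg : ~ M g by move=> Mg; exact: (Hg _ CC0).2 Mg _.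
  refine (Mmax (M `|` [set g]) _ _).
    split; first by move=> f; left.
    by move=> sub; apply: nMg; apply: sub; right.
  split=> [f [Mf|->] A CA|f h [Mf|->] [Mh|->] A CA //].
  - exact: M1 Mf _ CA.
  - by have [] := Hg A CA.
  - exact: M2 Mf Mh _ CA.
  - by move=> e; case: ((Hg A CA).2 f Mf).
  - by move=> e; case: ((Hg A CA).2 h Mh).
exists A => // A' CA'.
have /card_le_trans -> // : A #<= M.
  apply: (@card_le_trans _ _ _ ((fun f : set T -> T => f A) @` M)).
    by apply: subset_card_le => a /sA [f Mf <-]; exists f.
  exact: card_image_le.
have [t0 _] := Cn0 _ CC0.
have inj : {in M &, injective (fun f : set T -> T => f A')}.
  by move=> f g /set_mem Mf /set_mem Mg; exact: M2 Mf Mg _ CA'.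
apply: (@card_le_trans _ _ _ ((fun f : set T -> T => f A') @` M)).
  by rewrite (card_le_eqr (inj_card_eq inj)).
by apply: subset_card_le => _ [f Mf <-]; exact: M1 Mf _ CA'.
Qed.

Definition min_card (T : Type) (C : set (set T)) (C0 : C !=set0) : set T :=
  sval (cid2 (exists_min_card C0)).

Section Dimension.
Variables (k : fieldType) (V : lmodType k).
Implicit Types (E : set V).

Definition lin_indep E : Prop :=
  forall (s : seq V) (c : V -> k), uniq s -> (forall x, x \in s -> E x) ->
    \sum_(x <- s) c x *: x = 0 -> forall x, x \in s -> c x = 0.

Definition lin_span E : set V :=
  [set v | exists (s : seq V) (c : V -> k),
     (forall x, x \in s -> E x) /\ v = \sum_(x <- s) c x *: x].

Definition is_basis E : Prop := lin_indep E /\ lin_span E = setT.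

Lemma exists_basis : exists E, is_basis E.
Proof.
have [|E [indE maxE]] := @Zorn_bigcup V lin_indep.
  move=> Fs FsI tot s c us sF.
  case: s => [|y s] in us sF *; first by move=> _ x; rewrite in_nil.
  have [X FX sX] : exists2 X, Fs X & forall x, x \in y :: s -> X x.
    elim: s y {us} sF => [|z s IHs] y sF.
      have [X FX Xy] := sF y (mem_head _ _).
      by exists X => // x; rewrite inE => /eqP->.
    have [X0 FX0 X0y] := sF y (mem_head _ _).
    have [|X1 FX1 X1s] := IHs z.
      by move=> x xs; apply: sF; rewrite inE xs orbT.
    have [X01|X10] := tot _ _ FX0 FX1.
      by exists X1 => // x; rewrite inE => /predU1P[->|/X1s//]; exact: X01.
    by exists X0 => // x; rewrite inE => /predU1P[->//|/X1s]; exact: X10.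
  exact: (FsI _ FX).
exists E; split=> //; apply/seteqP; split=> // v _; apply: contrapT => nv.
have nEv : ~ E v.
  move=> Ev; apply: nv; exists [:: v], (fun=> 1).
  by split=> [x|]; rewrite ?inE ?big_seq1 ?scale1r // => /eqP->.
refine (maxE (E `|` [set v]) _ _).
  split; first by move=> x; left.
  by move=> sub; apply: nEv; apply: sub; right.
move=> s c us sE.
have [vs|nvs] := boolP (v \in s); last first.
  apply: indE => // x xs; have [//|/= xv] := sE x xs.
  by rewrite -xv xs in nvs.
have rE x : x \in rem v s -> E x.
  rewrite mem_rem_uniq // inE => /andP[xv xs].
  by have [//|/= xv'] := sE x xs; rewrite xv' eqxx in xv.
rewrite (big_rem v) //= => s0.
have cv : c v = 0.
  apply: contrapT => /eqP cv; apply: nv.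
  exists (rem v s), (fun x => - (c v)^-1 * c x); split=> //.
  under eq_bigr do rewrite -scalerA.
  rewrite -scaler_sumr; move/eqP: s0; rewrite addrC addr_eq0 => /eqP->.
  by rewrite scaleNr scalerN opprK scalerA mulVf // scale1r.
move: s0; rewrite cv scale0r add0r => s0 x.
have [-> //|xv xs] := eqVneq x v.
by apply: (indE _ _ (rem_uniq _ us) rE s0); rewrite mem_rem_uniq // inE xv.
Qed.

(* The dimension, possibly infinite, is the cardinality of this basis. *)
Definition dimension : set V := sval (cid exists_basis).

End Dimension.

Arguments dimension {k} V.

Section Subgroups.
Variable V : zmodType.

Definition is_subgroup (A : set V) : Prop :=
  A 0 /\ forall x y, A x -> A y -> A (x - y).

Definition subgroup_generated (X : set V) : set V := smallest is_subgroup X.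

Lemma subgroup_generatedP X : is_subgroup (subgroup_generated X).
Proof.
split=> [A [[A0 _] _] //|x y gx gy A gA].
by apply: gA.1.2; [exact: gx|exact: gy].
Qed.

End Subgroups.

Section ReductionModp.
Variables (V : zmodType) (p : nat).

Definition multiples : {pred V} := fun x => `[< exists y, x = y *+ p >].

Lemma multiples_zmod_closed : zmod_closed multiples.
Proof.
split; first by apply/asboolP; exists 0; rewrite mul0rn.
move=> x y /asboolP[x' ->] /asboolP[y' ->].
by apply/asboolP; exists (x' - y'); rewrite mulrnBl.
Qed.

HB.instance Definition _ :=
  GRing.isZmodClosed.Build V multiples multiples_zmod_closed.

Definition reduction_mod of prime p : Type := {ideal_quot multiples}.

Variable p_pr : prime p.
Local Notation Vp := (reduction_mod p_pr).

HB.instance Definition _ := GRing.Zmodule.on Vp.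

Lemma modp_mulrn0 (x : Vp) : x *+ p = 0.
Proof.
pose Q : zmodType := {ideal_quot multiples}.
change ((x : Q) *+ p = 0); rewrite -[x : Q]reprK -raddfMn.
rewrite -(raddf0 \pi_{ideal_quot multiples}); apply/eqP.
by rewrite -Quotient.idealrBE subr0; apply/asboolP; exists (repr (x : Q)).
Qed.

Lemma modp_mulrn_mod (x : Vp) n : x *+ (n %% p) = x *+ n.
Proof.
by rewrite [in RHS](divn_eq n p) mulrnDr mulnC mulrnA modp_mulrn0 mul0rn add0r.
Qed.

(* An element of 'F_p acts through its representative in {0, ..., p - 1}. *)
Definition modp_scale (a : 'F_p) (x : Vp) : Vp := x *+ a.

Lemma modp_scaleA a b x :
  modp_scale a (modp_scale b x) = modp_scale (a * b) x.
Proof.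
rewrite /modp_scale -mulrnA mulnC -[LHS]modp_mulrn_mod.
by congr (x *+ (_ %% _)%N); rewrite Fp_cast.
Qed.

Lemma modp_scale1 : left_id 1 modp_scale.
Proof. by []. Qed.

Lemma modp_scaleDr : right_distributive modp_scale +%R.
Proof. by move=> a x y; rewrite /modp_scale mulrnDl. Qed.

Lemma modp_scaleDl x : {morph modp_scale^~ x : a b / a + b}.
Proof.
move=> a b; rewrite /modp_scale -mulrnDr -[RHS]modp_mulrn_mod.
by congr (x *+ (_ %% _)%N); rewrite Fp_cast.
Qed.

HB.instance Definition _ := GRing.Zmodule_isLmodule.Build 'F_p Vp
  modp_scaleA modp_scale1 modp_scaleDr modp_scaleDl.

End ReductionModp.

Section CubicSurfaceGroups.
Variables (K : fieldType) (Kbar : closedFieldType) (iota : {rmorphism K -> Kbar}).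
Variable F : {mpoly K[4]}.

Local Notation SK := (rational_points F).

Definition spanning : set (set SK) := [set B | Span iota B = setT].

Lemma spanning_nonempty : spanning !=set0.
Proof. by exists setT; apply/seteqP; split=> // P _; exists 0%N. Qed.

(* r(S, K), as a set of that cardinality. *)
Definition surface_rank : set SK := min_card spanning_nonempty.

Local Notation G := {freeg SK}.

(* The first alternative entails that l is not contained in S. *)
Definition relations : set G := [set D | exists P Q R l,
  [/\ D = << P >> + << Q >> + << R >>, \dim l = 2%N &
      line_meets_at iota l P Q R \/
      Kline_in_surface iota F l /\
        [/\ (val P <= l)%VS, (val Q <= l)%VS & (val R <= l)%VS]]].

Definition GS' : set G := subgroup_generated relations.

Definition GS'' : {pred G} := fun D => `[< GS' D /\ deg D = 0 >].

Lemma GS''_zmod_closed : zmod_closed GS''.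
Proof.
have [g0 gB] := subgroup_generatedP relations.
split; first by apply/asboolP; split; [exact: g0|exact: deg0].
move=> D E /asboolP[gD dD] /asboolP[gE dE]; apply/asboolP.
by split; [exact: gB|rewrite degB dD dE subrr].
Qed.

HB.instance Definition _ := GRing.isZmodClosed.Build G GS'' GS''_zmod_closed.

Definition HS : Type := {ideal_quot GS''}.

HB.instance Definition _ := GRing.Zmodule.on HS.

Definition HS_class (D : G) : HS := \pi_{ideal_quot GS''} D.

Definition HS_deg (D : HS) : int := deg (repr (D : {ideal_quot GS''})).

Lemma HS_deg_class D : HS_deg (HS_class D) = deg D.
Proof.
apply/eqP; rewrite -subr_eq0 -degB.
have : repr (\pi_{ideal_quot GS''} D) - D \in GS''.
  by rewrite Quotient.idealrBE reprK.
by case/asboolP=> _ ->.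
Qed.

Definition HS0 : {pred HS} := [pred D | HS_deg D == 0].

Lemma HS0_zmod_closed : zmod_closed HS0.
Proof.
split; first by rewrite inE -(raddf0 \pi_{ideal_quot GS''}) HS_deg_class deg0.
move=> x y; rewrite !inE -[x]reprK -[y]reprK -raddfB !HS_deg_class degB.
by move=> /eqP-> /eqP->; rewrite subrr.
Qed.

HB.instance Definition _ := GRing.isZmodClosed.Build HS HS0 HS0_zmod_closed.

Definition HS0_group : Type := {D : HS | D \in HS0}.

HB.instance Definition _ := SubChoice.on HS0_group.
HB.instance Definition _ := [SubChoice_isSubZmodule of HS0_group by <:].

End CubicSurfaceGroups.

Arguments spanning {K Kbar} iota F.
Arguments surface_rank {K Kbar} iota F.
Arguments relations {K Kbar} iota F.
Arguments GS' {K Kbar} iota F.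
Arguments GS'' {K Kbar} iota F.
Arguments HS0 {K Kbar} iota F.

(* Main.v *)
Require Import Defs.
From mathcomp Require Import all_boot all_order all_algebra.
From mathcomp Require Import generic_quotient ring_quotient.
From mathcomp Require Import boolp classical_sets functions cardinality.
From mathcomp Require Import freeg mpoly.

(** Everything rests on one relation. Since P0 is ternary, some K-line l through
    P0 either lies in S, or meets S at P0 with multiplicity at least 3 and hence,
    S being a cubic, exactly in 3 P0; in both cases 3 P0 lies in G'_S(K)
    ([ternary_relation]). Consequently, if a line cuts out P + Q + R, then
    (P + Q + R) - 3 P0 is a relation of degree 0, that is
      [R - P0] = - [P - P0] - [Q - P0]    ([collinear_diff_class]).
    So the subgroup generated by the [P - P0] with P in B is stable under every
    step of the construction of Span(B): it contains [R - P0] for all R in S(K)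
    once B spans. A divisor sum a_i P_i of degree 0 equals
    sum a_i (P_i - P0), so these classes fill H^0_S(K).

    The only geometry is the exact count on l. If F is homogeneous of degree d
    and F(p + T q) vanishes to order d at T = 0, then F(p + T q) = c T^d for
    reasons of degree, whence F(a p + b q) = c b^d by homogeneity; either c = 0
    and the line is in S, or F vanishes on the line only at <p>, to order
    exactly d ([intersection_mult_top_contact]).

    For the bound on the rank, the classes of the [P - P0], for P in a spanning
    set of least cardinality, span H^0 / p H^0 over F_p, so what is left is that
    a basis is no larger than a spanning set. All cardinals may be infinite. The
    usual argument for infinite bases uses the arithmetic of infinite cardinals;
    instead, the Steinitz exchange is carried out transfinitely by
    Zorn's lemma ([card_lin_indep_le_span]), which treats the finite and the
    infinite cases at once. *)

Set Implicit Arguments.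
Unset Strict Implicit.
Unset Printing Implicit Defensive.

Import GRing.Theory.
Local Open Scope classical_set_scope.
Local Open Scope card_scope.
Local Open Scope quotient_scope.
Local Open Scope ring_scope.

(** * Contact of maximal order of a line with a hypersurface *)

Section LineRestriction.
Variable L : fieldType.
Implicit Types (G : {mpoly L[4]}) (p q v : 'rV[L]_4) (X l : {vspace 'rV[L]_4}).

Lemma meval_homogZ d G : G \is d.-homog ->
  forall a v, G.@[(a *: v) 0] = a ^+ d * G.@[v 0].
Proof.
move=> /dhomogP Gd a v; rewrite !mevalE mulr_sumr; apply: eq_big_seq => m mG.
rewrite mulrCA; congr (_ * _); rewrite -(Gd _ mG) /= mdegE -prodrXr -big_split /=.
by apply: eq_bigr => i _; rewrite mxE exprMn.
Qed.

Lemma horner_line_restriction G p q t :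
  (line_restriction G p q).[t] = G.@[(p + t *: q) 0].
Proof.
rewrite mevalE /line_restriction /mmap horner_sum; apply: eq_bigr => m _.
rewrite hornerM hornerC /mmap1 horner_prod; congr (_ * _).
by apply: eq_bigr => i _; rewrite !hornerE !mxE mulrC.
Qed.

Lemma size_line_restriction d G p q : G \is d.-homog ->
  (size (line_restriction G p q) <= d.+1)%N.
Proof.
move=> /dhomogP Gd; rewrite /line_restriction /mmap big_seq.
apply: (leq_trans (size_sum _ _ _)); apply/bigmax_leqP_seq => m mG _.
rewrite mul_polyC; apply: (leq_trans (size_scale_leq _ _)).
rewrite -(Gd _ mG) /= mdegE.
rewrite /mmap1; elim/big_ind2: _ => [|f a g b fa gb|i _].
- by rewrite size_poly1.
- by apply: (leq_trans (size_polyMleq _ _)); rewrite -subn1 leq_subLR;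
    rewrite (leq_trans (leq_add fa gb)) // addSn addnS.
- apply: (leq_trans (size_poly_exp_leq _ _)); rewrite ltnS.
  rewrite -[leqRHS]mul1n leq_mul2r -subn1 leq_subLR.
  apply/orP; right; apply: (leq_trans (size_polyD _ _)).
  rewrite geq_max (leq_trans (size_polyC_leq1 _)) //.
  by rewrite (leq_trans (size_scale_leq _ _)) ?size_polyX.
Qed.

(** The restriction has degree at most d and is divisible by T^d; when it is 0,
    its multiplicity at 0 carries no information but c = 0 works. *)
Lemma line_restriction_top_mult d G p q : G \is d.-homog ->
  (d <= mup 0 (line_restriction G p q))%N ->
  exists c, line_restriction G p q = c *: 'X^d.
Proof.
move=> Gd; have [->|h0] := eqVneq (line_restriction G p q) 0.
  by move=> _; exists 0; rewrite scale0r.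
rewrite mup_geq // subr0 => /dvdpP[g hE]; exists g`_0.
have g0 : g != 0 by apply: contraNneq h0 => g0; rewrite hE g0 mul0r.
have := size_line_restriction p q Gd; rewrite hE size_Mmonic ?monicXn //.
rewrite size_polyXn addnS /= -[leqRHS]add1n leq_add2r.
by move=> /size1_polyC {1}->; rewrite mul_polyC.
Qed.

Lemma dim1_vline X : \dim X = 1%N -> X = <[vpick X]>%VS.
Proof.
move=> dX; apply/eqP; rewrite eq_sym eqEdim -memvE memv_pick dX dim_vline /=.
by rewrite vpick0 -dimv_eq0 dX.
Qed.

(** These are the coordinates implicit in [intersection_mult], whose second
    vector spans the chosen complement of X in l. *)
Lemma memv_line_split l X v : \dim l = 2%N -> \dim X = 1%N -> (X <= l)%VS ->
  v \in l -> exists a b, v = a *: vpick X + b *: vpick (l :\: X)%VS.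
Proof.
move=> dl dX Xl vl.
have dD : \dim (l :\: X) = 1%N.
  have := dimv_cap_compl l X; rewrite (capv_idPr Xl) dX dl add1n.
  by case.
move: vl; rewrite -{1}(addv_diff_cap l X) (capv_idPr Xl) => /memv_addP[u uD [w wX ->]].
have /vlineP[b ->] : u \in <[vpick (l :\: X)%VS]>%VS by rewrite -dim1_vline.
have /vlineP[a ->] : w \in <[vpick X]>%VS by rewrite -dim1_vline.
by exists a, b; rewrite addrC.
Qed.

End LineRestriction.

Section TopContact.
Variable L : closedFieldType.
Implicit Types (G : {mpoly L[4]}) (p q v : 'rV[L]_4) (X l : {vspace 'rV[L]_4}).

(** For a != 0 this is F(a p + b q) = a^d F(p + (b / a) q). The value at a = 0,
    the point q at infinity of the parametrization, follows because both sides
    are polynomials in a and L is infinite. *)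
Lemma meval_top_contact d G p q c : G \is d.-homog ->
  line_restriction G p q = c *: 'X^d ->
  forall a b, G.@[(a *: p + b *: q) 0] = c * b ^+ d.
Proof.
move=> Gd hE a b; pose r := line_restriction G (b *: q) p - (c * b ^+ d)%:P.
suff r0 : r = 0.
  have : r.[a] = 0 by rewrite r0 horner0.
  rewrite hornerD hornerN hornerC horner_line_restriction addrC => /eqP.
  by rewrite addrC subr_eq0 addrC => /eqP.
(* The factor 'X discards a = 0, where the homogeneity argument fails; a nonzero
   polynomial over L has a non-root. *)
have rX : 'X * r = 0.
  apply/eqP; apply: contraT => /closed_nonrootP[t].
  rewrite rootE hornerM hornerX mulf_eq0 negb_or => /andP[t0 /eqP[]].
  rewrite hornerD hornerN hornerC horner_line_restriction.
  have -> : b *: q + t *: p = t *: (p + (b / t) *: q).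
    by rewrite scalerDr scalerA addrC mulrCA divff // mulr1.
  rewrite (meval_homogZ Gd) -horner_line_restriction hE hornerZ hornerXn.
  by rewrite mulrCA -exprMn mulrCA divff // mulr1 subrr.
by apply/eqP; move/eqP: rX; rewrite mulf_eq0 polyX_eq0.
Qed.

(** A form c b^d with c != 0 vanishes only at b = 0: the contact of order d
    exhausts the intersection of the line with the hypersurface. *)
Lemma intersection_mult_top_contact d G l X0 : G \is d.-homog ->
  \dim l = 2%N -> \dim X0 = 1%N -> (X0 <= l)%VS -> ~ line_in_surface G l ->
  (d <= intersection_mult G l X0)%N ->
  forall X, \dim X = 1%N -> intersection_mult G l X = (d * (X == X0))%N.
Proof.
move=> Gd dl dX0 X0l nGl; rewrite /intersection_mult X0l.
move=> /(line_restriction_top_mult Gd)[c hE] X dX.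
have ev := meval_top_contact Gd hE.
have c0 : c != 0.
  apply/eqP => c0; apply: nGl => v /(memv_line_split dl dX0 X0l)[a [b ->]].
  by rewrite ev c0 mul0r.
have [->|XX0] := eqVneq X X0.
  rewrite X0l hE -mul_polyC mupMr; last by rewrite rootC.
  by rewrite muln1 -['X]subr0 mup_XsubCX eqxx.
rewrite muln0; case: ifP => // Xl; apply: mupNroot.
rewrite rootE horner_line_restriction scale0r addr0.
have [a [b vE]] := memv_line_split dl dX0 X0l (subvP Xl _ (memv_pick X)).
rewrite vE ev mulf_neq0 // expf_neq0 //; apply: contraNneq XX0 => b0.
rewrite eqEdim dX dX0 leqnn andbT (dim1_vline dX) -memvE vE b0 scale0r addr0.
by rewrite memvZ // memv_pick.
Qed.

End TopContact.

(** * Extension of scalars for subspaces *)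

Lemma memv_span_mx (F : fieldType) (n k : nat) (X : k.-tuple 'rV[F]_n)
    (v : 'rV[F]_n) :
  (v \in <<X>>%VS) = (v <= \matrix_(i < k) X`_i)%MS.
Proof.
apply/idP/submxP => [/coord_span ->|[c ->]].
  exists (\row_i coord X i v); rewrite mulmx_sum_row; apply: eq_bigr => i _.
  by rewrite mxE rowK.
rewrite mulmx_sum_row memv_suml // => i _; rewrite rowK memvZ //.
by rewrite memv_span // mem_nth // size_tuple.
Qed.

(** Membership is a rank condition on matrices, and ranks do not change under an
    extension of fields. *)
Lemma memv_base_change (K : fieldType) (Kbar : closedFieldType)
    (iota : {rmorphism K -> Kbar}) (U : {vspace 'rV[K]_4}) v :
  (map_mx iota v \in base_change iota U) = (v \in U).
Proof.
have -> : (v \in U) = (v <= \matrix_(i < \dim U) (vbasis U)`_i)%MS.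
  by rewrite -memv_span_mx (span_basis (vbasisP U)).
rewrite -(map_submx iota).
have -> : map_mx iota (\matrix_(i < \dim U) (vbasis U)`_i) =
    \matrix_(i < \dim U) [tuple of [seq map_mx iota u | u <- vbasis U]]`_i.
  apply/row_matrixP => i; rewrite -map_row !rowK (nth_map 0) ?size_tuple //.
by rewrite -memv_span_mx.
Qed.

Lemma base_change_sub (K : fieldType) (Kbar : closedFieldType)
    (iota : {rmorphism K -> Kbar}) (U W : {vspace 'rV[K]_4}) :
  (base_change iota U <= base_change iota W)%VS = (U <= W)%VS.
Proof.
apply/subvP/subvP => sUW v; last first.
  apply: subvP; apply/span_subvP => _ /mapP[u uU ->].
  by rewrite memv_base_change sUW // vbasis_mem.
by rewrite -!(memv_base_change iota); exact: sUW.
Qed.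

Lemma dim_base_change1 (K : fieldType) (Kbar : closedFieldType)
    (iota : {rmorphism K -> Kbar}) (U : {vspace 'rV[K]_4}) :
  \dim U = 1%N -> \dim (base_change iota U) = 1%N.
Proof.
move=> dU; rewrite /base_change; move: (vbasisP U); move: (vbasis U).
rewrite dU => /tupleP[u X]; rewrite (tuple0 X) /= => /basis_free; rewrite span_seq1 dim_vline seq1_free.
by rewrite -(map_mx_eq0 iota) => ->.
Qed.

(** * Infinite Steinitz exchange *)

Section Exchange.
Variables (k : fieldType) (V : lmodType k).
Implicit Types (E W : set V) (g : V -> V) (M : set (V * V)).

(** In [fam_span] and [fam_indep] a set E of indices, taken in V itself, carries
    the family g of vectors. Independence is that of the family, not of its
    image, so that it forces g to be injective on E. Repeated indices are
    harmless in a span, and allowing them makes its closure properties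
    immediate. *)
Definition fam_span g E : set V :=
  [set v | exists r : seq (k * V), (forall i, i \in r -> E i.2) /\
     v = \sum_(i <- r) i.1 *: g i.2].

Definition fam_indep g E : Prop :=
  forall (s : seq V) (c : V -> k), uniq s -> (forall x, x \in s -> E x) ->
    \sum_(x <- s) c x *: g x = 0 -> forall x, x \in s -> c x = 0.

Lemma fam_span0 g E : fam_span g E 0.
Proof. by exists [::]; split=> //; rewrite big_nil. Qed.

Lemma fam_span_base g E x : E x -> fam_span g E (g x).
Proof.
move=> Ex; exists [:: (1, x)]; split=> [i|]; first by rewrite inE => /eqP->.
by rewrite big_seq1 scale1r.
Qed.

Lemma fam_spanD g E v w : fam_span g E v -> fam_span g E w -> fam_span g E (v + w).
Proof.
move=> [r [rE ->]] [r' [rE' ->]]; exists (r ++ r'); split; last by rewrite big_cat.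
by move=> i; rewrite mem_cat => /orP[/rE|/rE'].
Qed.

Lemma fam_spanZ g E a v : fam_span g E v -> fam_span g E (a *: v).
Proof.
move=> [r [rE ->]]; exists [seq (a * i.1, i.2) | i <- r]; split.
  by move=> i /mapP[j jr ->]; exact: rE jr.
by rewrite big_map scaler_sumr; apply: eq_bigr => i _; rewrite scalerA.
Qed.

Lemma fam_span_sum g E (s : seq V) (c : V -> k) (f : V -> V) :
  (forall x, x \in s -> fam_span g E (f x)) ->
  fam_span g E (\sum_(x <- s) c x *: f x).
Proof.
move=> sE; rewrite big_seq; elim/big_rec: _ => [|x v xs vE].
  exact: fam_span0.
by apply: fam_spanD => //; apply: fam_spanZ; exact: sE.
Qed.

Lemma fam_span_uniq g E v : fam_span g E v ->
  exists s (c : V -> k), [/\ uniq s, forall x, x \in s -> E x &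
    v = \sum_(x <- s) c x *: g x].
Proof.
move=> [r [rE ->]]; elim: r rE => [|[a y] r IHr] rE.
  by exists [::], (fun=> 0); rewrite !big_nil.
have [|s [c [us sE]]] := IHr; first by move=> i ir; apply: rE; rewrite inE ir orbT.
rewrite big_cons /= => ->.
have Ey : E y by have /= := rE (a, y) (mem_head _ _).
have [ys|nys] := boolP (y \in s).
  exists s, (fun x => if x == y then a + c y else c x); split=> //.
  rewrite !(big_rem y ys) /= eqxx addrA -scalerDl; congr (_ + _).
  by apply: eq_big_seq => x; rewrite mem_rem_uniq // inE => /andP[/negPf->].
exists (y :: s), (fun x => if x == y then a else c x); split.
- by rewrite /= nys.
- by move=> x; rewrite inE => /predU1P[->|/sE].
- rewrite big_cons eqxx; congr (_ + _); apply: eq_big_seq => x xs.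
  by case: eqVneq => // xy; rewrite -xy xs in nys.
Qed.

Lemma lin_spanE E : lin_span E = fam_span id E.
Proof.
apply/seteqP; split=> v.
  move=> [s [c [sE ->]]]; apply: fam_span_sum => x xs.
  exact: (@fam_span_base id) (sE x xs).
by move=> /fam_span_uniq[s [c [_ sE ->]]]; exists s, c.
Qed.

(** If a relation involves the new vector w, dividing by its coefficient puts w
    in the span of the others; if not, it is a relation of the old family. *)
Lemma fam_indep_update g E e w : E e -> fam_indep g E ->
  ~ fam_span g (E `\ e) w ->
  fam_indep (fun x => if x == e then w else g x) E.
Proof.
move=> Ee indg nw s c us sE.
have eq_sum (t : seq V) : e \notin t ->
    \sum_(x <- t) c x *: (if x == e then w else g x) = \sum_(x <- t) c x *: g x.
  move=> et; apply: eq_big_seq => x xt.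
  by case: eqVneq => // xe; rewrite -xe xt in et.
have [es|nes] := boolP (e \in s); last by rewrite eq_sum //; exact: indg.
have ner : e \notin rem e s by rewrite mem_rem_uniqF.
have rE x : x \in rem e s -> (E `\ e) x.
  by rewrite mem_rem_uniq // inE => /andP[/eqP xe /sE].
rewrite (big_rem e es) /= eqxx eq_sum // => s0.
have ce : c e = 0.
  apply: contrapT => /eqP ce; apply: nw.
  have -> : w = - (c e)^-1 *: \sum_(x <- rem e s) c x *: g x.
    move/eqP: s0; rewrite addrC addr_eq0 => /eqP->.
    by rewrite scaleNr scalerN opprK scalerA mulVf // scale1r.
  by apply/fam_spanZ/fam_span_sum => x /rE; exact: fam_span_base.
move: s0; rewrite ce scale0r add0r => s0 x.
have [-> //|xe xs] := eqVneq x e.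
by apply: (indg _ _ (rem_uniq _ us) _ s0) => [y /rE[]//|]; rewrite mem_rem_uniq // inE xe.
Qed.

Lemma fam_indep_nspan g E e : E e -> fam_indep g E -> ~ fam_span g (E `\ e) (g e).
Proof.
move=> Ee indg /fam_span_uniq[s [c [us sE ge]]].
have nes : e \notin s by apply/negP => /sE[_]; exact.
suff : (-1 : k) = 0 by apply/eqP; rewrite oppr_eq0 oner_eq0.
have := indg (e :: s) (fun x => if x == e then -1 else c x) _ _ _ e (mem_head _ _).
rewrite eqxx; apply.
- by rewrite /= nes.
- by move=> x; rewrite inE => /predU1P[->//|/sE[]].
- rewrite big_cons eqxx scaleN1r; apply/eqP; rewrite addrC subr_eq0 ge.
  apply/eqP; apply: eq_big_seq => x xs.
  by case: eqVneq => // xe; rewrite -xe xs in nes.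
Qed.

(** M is read as the graph of a partial map; outside its domain [replace M] is the
    identity, by the default value of [xget]. *)
Definition replace M x : V := xget x [set w | M (x, w)].

(** The objects to which Zorn's lemma applies: partial maps from E to W such that E,
    with the vectors of the domain replaced by their images, remains
    independent. Injectivity of the map is a consequence. *)
Definition exchange E W M : Prop :=
  [/\ forall x w, M (x, w) -> E x /\ W w,
      forall x w w', M (x, w) -> M (x, w') -> w = w' &
      fam_indep (replace M) E].

(** Independence has finite character: a relation involves finitely many indices,
    and on them the union of the chain agrees with a single member of it, or
    with the empty map when none of them lies in the domain. *)
Lemma exchange_bigcup E W (Fs : set (set (V * V))) : lin_indep E ->
  Fs `<=` exchange E W -> total_on Fs subset ->
  exchange E W (\bigcup_(M in Fs) M).
Proof.
move=> indE FsX tot; set U := \bigcup_(M in Fs) M.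
have Ufun x w w' : U (x, w) -> U (x, w') -> w = w'.
  move=> [M FM Mw] [N FN Nw].
  have [MN|NM] := tot _ _ FM FN.
    by have [_ + _] := FsX _ FN; apply; [exact: MN Mw|exact: Nw].
  by have [_ + _] := FsX _ FM; apply; [exact: Mw|exact: NM Nw].
split=> // [x w [M FM Mw]|s c us sE s0].
  by have [+ _ _] := FsX _ FM; apply; exact: Mw.
have [M [FM MU]] : exists M, (Fs M \/ M = set0) /\
    forall x w, x \in s -> U (x, w) -> M (x, w).
  elim: s {us sE s0} => [|y s [M [FM MU]]]; first by exists set0; split; [right|].
  have [[w Uyw]|nUy] := pselect (exists w, U (y, w)); last first.
    exists M; split=> // x w; rewrite inE => /predU1P[-> Uyw|]; last exact: MU.
    by case: nUy; exists w.
  have [N FN Nyw] := Uyw.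
  have Ny w' : U (y, w') -> N (y, w') by move=> /(Ufun _ _ _ Uyw) <-.
  case: FM => [FM|M0].
    have [MN|NM] := tot _ _ FM FN.
      exists N; split=> [|x w']; first by left.
      rewrite inE => /predU1P[->|xs Ux]; first exact: Ny.
      exact/MN/MU.
    exists M; split=> [|x w']; first by left.
    by rewrite inE => /predU1P[-> /Ny/NM|]; [|exact: MU].
  exists N; split=> [|x w']; first by left.
  rewrite inE => /predU1P[->|xs Ux]; first exact: Ny.
  by have := MU _ _ xs Ux; rewrite M0.
have indM : fam_indep (replace M) E.
  case: FM => [/FsX[]//|->] t d ut tE t0; apply: (indE t d) => //.
  rewrite -[RHS]t0; apply: eq_bigr => x _; congr (_ *: _).
  by rewrite /replace xgetPN // => w [].
have MsubU : M `<=` U by case: FM => [FM z Mz|-> z []//]; exists M.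
apply: indM us sE _; rewrite -[RHS]s0; apply: eq_big_seq => x xs.
congr (_ *: _); rewrite /replace; congr (xget _ _).
by apply/seteqP; split=> w /=; [exact: MsubU|exact: MU].
Qed.

(** Take a maximal exchange. If e were an index left unreplaced, the vectors with
    index other than e would not span e, so some w in W lies outside their span
    and can replace e, against maximality. So the exchange is total, and it
    injects E into W. *)
Lemma card_lin_indep_le_span E W :
  lin_indep E -> lin_span W = setT -> E #<= W.
Proof.
move=> indE spanW.
have [M [[MEW Mfun indM] Mmax]] := @Zorn_bigcup _ (exchange E W)
  (fun Fs => @exchange_bigcup E W Fs indE).
have Mtotal e : E e -> exists w, M (e, w).
  move=> Ee; apply: contrapT => nMe.
  have [w Ww nw] : exists2 w, W w & ~ fam_span (replace M) (E `\ e) w.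
    (* Otherwise W, hence everything, lies in the span of the other vectors. *)
    apply: contrapT => nW; apply: (fam_indep_nspan Ee indM).
    have [s [c [sW ->]]] : lin_span W (replace M e) by rewrite spanW.
    apply: fam_span_sum => x /sW Wx; apply: contrapT => nx.
    by apply: nW; exists x.
  apply: (Mmax (M `|` [set (e, w)])).
    split=> [|sub]; first by move=> z; left.
    by apply: nMe; exists w; apply: sub; right.
  split=> [x y [/MEW//|/= [-> ->]//]|x y y' [Mx|/= [-> ->]] [Mx'|/= []]|].
  - exact: Mfun Mx Mx'.
  - by move=> xe _; case: nMe; exists y; rewrite -xe.
  - by case: nMe; exists y'.
  - by [].
  - move=> s c us sE s0; apply: (fam_indep_update Ee indM nw us sE).
    rewrite -[RHS]s0; apply: eq_bigr => x _; congr (_ *: _).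
    case: eqVneq => [->|xe]; rewrite /replace.
      apply/esym/xget_unique => [|y [Mey|/= []//]]; first by right.
      by case: nMe; exists y.
    congr (xget _ _); apply/seteqP; split=> y /=; first by left.
    by move=> [//|[xe']]; rewrite xe' eqxx in xe.
have MrE x : E x -> M (x, replace M x).
  by move=> /Mtotal[w Mw]; exact: (@xgetI _ x [set w | M (x, w)] w).
have injM : {in E &, injective (replace M)}.
  move=> x y /set_mem Ex /set_mem Ey xy; apply: contrapT => /eqP nxy.
  apply: (fam_indep_nspan Ex indM); rewrite xy; apply: fam_span_base; split=> //=.
  by move=> yx; rewrite yx eqxx in nxy.
rewrite -(card_le_eql (inj_card_eq injM)).
by apply: subset_card_le => _ [x Ex <-]; have [] := MEW _ _ (MrE x Ex).
Qed.

End Exchange.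

(** * Classes of differences of points *)

Section ClassGroup.
Variables (K : fieldType) (Kbar : closedFieldType) (iota : {rmorphism K -> Kbar}).
Variable F : {mpoly K[4]}.
Implicit Types (P Q R : rational_points F) (B : set (rational_points F)).
Implicit Types D E : {freeg (rational_points F)}.

Lemma dhomog_map_mpoly d : F \is d.-homog -> Fbar iota F \is d.-homog.
Proof.
move=> /dhomogP Fd; apply/dhomogP => m; rewrite mcoeff_msupp mcoeff_map_mpoly /=.
by rewrite fmorph_eq0 -mcoeff_msupp; exact: Fd.
Qed.

(** The two alternatives for an asymptotic line are exactly the two kinds of
    relations, with P = Q = R. *)
Lemma ternary_relation P : F \is 3.-homog -> K_ternary iota P ->
  relations iota F (<< P >> + << P >> + << P >>).
Proof.
move=> F3 [m mP [l dl ml]]; subst m; have [dm Pm mS] := mP.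
exists P, P, P, l; split=> //.
have dP : \dim (base_change iota (val P)) = 1%N.
  by apply: dim_base_change1; have /andP[/eqP] := valP P.
have [lS|nlS] := pselect (Kline_in_surface iota F l).
  by right; split=> //; rewrite -(base_change_sub iota).
left; split=> // X dX; case: mS => // mult3.
rewrite (intersection_mult_top_contact (dhomog_map_mpoly F3) dm dP Pm nlS) //.
by rewrite -addnA mulSn mulSn mul1n.
Qed.

Lemma HS_classB D E : HS_class iota (D - E) = HS_class iota D - HS_class iota E.
Proof. by rewrite /HS_class raddfB. Qed.

Lemma HS_class_eq0 D : GS' iota F D -> deg D = 0 -> HS_class iota D = 0.
Proof.
move=> gD dD; rewrite /HS_class -(raddf0 \pi_{ideal_quot (GS'' iota F)}).
by apply/eqP; rewrite -Quotient.idealrBE subr0; apply/asboolP.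
Qed.

Lemma HS_class_in_HS0 D : (HS_class iota D \in HS0 iota F) = (deg D == 0).
Proof. by rewrite inE HS_deg_class. Qed.

Section Generation.
Variable P0 : rational_points F.
Hypothesis triple_P0 : relations iota F (<< P0 >> + << P0 >> + << P0 >>).

Let diff_class P : HS iota F := HS_class iota (<< P >> - << P0 >>).

(** The degree 3 relation P + Q + R is corrected to degree 0 by 3 P0, itself a
    relation. *)
Lemma collinear_diff_class P Q R :
  relations iota F (<< P >> + << Q >> + << R >>) ->
  diff_class R = - diff_class P - diff_class Q.
Proof.
move=> PQR; apply/eqP; rewrite -subr_eq0 -opprD opprK addrC.
rewrite /diff_class /HS_class -!raddfD /=.
have -> : << P >> - << P0 >> + (<< Q >> - << P0 >>) + (<< R >> - << P0 >>) =
    (<< P >> + << Q >> + << R >>) - (<< P0 >> + << P0 >> + << P0 >>) :> {freeg _}.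
  by rewrite (addrACA << P >>) (addrACA (<< P >> + << Q >>)) !opprD.

apply/eqP/HS_class_eq0.
  by apply: (subgroup_generatedP (relations iota F)).2 => A [_ sA]; exact: sA.
by rewrite degB !degD !degU subrr.
Qed.

Lemma Span_sub_generated B R : Span iota B R ->
  subgroup_generated [set diff_class P | P in B] (diff_class R).
Proof.
have [g0 gB] := subgroup_generatedP [set diff_class P | P in B].
move=> [n _]; elim: n R => [|n IHn] R /=.
  by move=> BR A [_ sA]; apply: sA; exists R.
move=> [/IHn //|[P [Q [l [/IHn gP /IHn gQ dl lPQR]]]]].
rewrite (@collinear_diff_class P Q R).
  by apply: (gB) gQ; rewrite -[- _]sub0r; exact: gB.
by exists P, Q, R, l; split=> //; left.
Qed.

(** A divisor D with coefficients a_i differs from the sum of the a_i (P_i - P0)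
    by (deg D) P0, which is 0 in degree 0. *)
Lemma diff_class_generate B : Span iota B = setT ->
  subgroup_generated [set diff_class P | P in B] = [set D | D \in HS0 iota F].
Proof.
move=> spanB; have [g0 gB] := subgroup_generatedP [set diff_class P | P in B].
apply/seteqP; split=> x /=.
  move=> gx; apply: (gx [set D | D \in HS0 iota F]); split.
    by split=> [|y z] /=; [exact: rpred0|exact: rpredB].
  by move=> _ [P _ <-] /=; rewrite HS_class_in_HS0 degB !degU subrr.
rewrite -[x]reprK; move: (repr _) => D; rewrite -/(HS_class iota D).
rewrite HS_class_in_HS0 => /eqP dD.
pose A := subgroup_generated [set diff_class P | P in B].
have gN y : A y -> A (- y) by rewrite -[- y]sub0r; exact: gB.
have gD y z : A y -> A z -> A (y + z).
  by move=> Ay /gN Az; rewrite -[z]opprK; exact: gB.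
have gMn y n : A y -> A (y *+ n).
  by move=> Ay; elim: n => // n IHn; rewrite mulrS; exact: gD.
have gMz y (k : int) : A y -> A (y *~ k).
  by case: k => n Ay; [exact: gMn|apply: gN; exact: gMn].
suff : A (HS_class iota D - HS_class iota << P0 >> *~ deg D).
  by rewrite dD mulr0z subr0.
(* For a divisor of arbitrary degree the excess deg D is carried by P0, which
   makes the statement additive in D. *)
elim/freeg_ind_dom0: D {dD} => [|k P D _ _ IHD].
  by rewrite deg0 mulr0z subr0 /HS_class raddf0.
have -> : HS_class iota (<< k *g P >> + D) -
      HS_class iota << P0 >> *~ deg (<< k *g P >> + D) =
    diff_class P *~ k + (HS_class iota D - HS_class iota << P0 >> *~ deg D).
  rewrite degD degU mulrzDr /diff_class HS_classB mulrzBl [RHS]addrACA -opprD.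
  congr (_ - _); rewrite /HS_class raddfD /= -[X in << X *g P >>]intz.
  by rewrite -freegU_mulz raddfMz.
apply: gD => //; apply: gMz.
by apply: Span_sub_generated; rewrite spanB.
Qed.

End Generation.
End ClassGroup.

(** * Dimension of the reduction modulo p *)

(** Transfers generation from the ambient group, where the subgroup is a
    predicate, to the subgroup as a group in its own right. *)
Lemma subgroup_generated_val (U : zmodType) (A : pred U)
    (V : subZmodType A) (X : set V) :
  subgroup_generated [set val x | x in X] = [set u | u \in A] ->
  subgroup_generated X = setT.
Proof.
move=> genA; apply/seteqP; split=> // v _.
have [g0 gB] := subgroup_generatedP X.
have : subgroup_generated [set val x | x in X] (val v) by rewrite genA; exact: valP.
move=> /(_ [set val x | x in subgroup_generated X])[|w gw /val_inj <- //].
split; last by move=> _ [x Xx <-]; exists x => // B [_]; exact.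
split; first by exists 0; rewrite ?raddf0.
by move=> _ _ [x gx <-] [y gy <-]; exists (x - y); [exact: gB|rewrite raddfB].
Qed.

(** The elements of V whose reduction is an F_p-combination of reductions of
    elements of X form a subgroup containing X. *)
Lemma lin_span_reduction_mod (V : zmodType) (p : nat) (p_pr : prime p)
    (X : set V) : subgroup_generated X = setT ->
  lin_span [set (\pi_{ideal_quot (@multiples V p)} x : reduction_mod V p_pr) | x in X]
    = setT.
Proof.
move=> genX; apply/seteqP; split=> // v _; rewrite lin_spanE.
set W := [set _ | _ in X]; set S := fam_span id W.
have gen : subgroup_generated X `<=`
    [set x | S (\pi_{ideal_quot (@multiples V p)} x)].
  move=> x; apply; split; last first.
    by move=> y Xy; apply: (@fam_span_base _ _ id W); exists y.
  split=> [|y z Sy Sz] /=; first by rewrite raddf0; exact: fam_span0.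
  rewrite raddfB; apply: fam_spanD => //.
  by have := fam_spanZ (-1) Sz; rewrite scaleN1r.
rewrite -[v](@reprK _ {ideal_quot (@multiples V p)}).
by apply: gen; rewrite genX.
Qed.

Lemma dimension_reduction_mod_le (V : zmodType) (p : nat) (p_pr : prime p)
    (X : set V) : subgroup_generated X = setT ->
  dimension (reduction_mod V p_pr) #<= X.
Proof.
move=> /(lin_span_reduction_mod p_pr) spanX.
have [indE _] : is_basis (dimension (reduction_mod V p_pr)).
  exact: (svalP (cid (exists_basis _))).
exact: card_le_trans (card_lin_indep_le_span indE spanX) (card_image_le _ _).
Qed.

(** * Generation of H^0 and the lower bound on the rank *)

Theorem theorem5 (K : fieldType) (Kbar : closedFieldType)
    (iota : {rmorphism K -> Kbar})
    (Kbar_algebraic : forall x : Kbar, algebraicOver iota x)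
    (F : {mpoly K[4]}) (F_cubic : F \is 3.-homog)
    (F_smooth : smooth_surface iota F)
    (P0 : rational_points F) (P0_ternary : K_ternary iota P0) :
  (forall B : set (rational_points F), Span iota B = [set: rational_points F] ->
     subgroup_generated [set HS_class iota (<< P >> - << P0 >>) | P in B]
       = [set D : HS iota F | D \in HS0 iota F]) /\
  (forall (p : nat) (p_prime : prime p),
     dimension (reduction_mod (HS0_group iota F) p_prime) #<= surface_rank iota F).
Proof.
have gen := diff_class_generate (ternary_relation F_cubic P0_ternary).
split=> [|p p_pr]; first exact: gen.
(* The classes [P - P0] as elements of the group H^0 itself. *)
have d0 P : HS_class iota (<< P >> - << P0 >>) \in HS0 iota F.
  by rewrite HS_class_in_HS0 degB !degU subrr.
pose d P : HS0_group iota F := exist (fun D => D \in HS0 iota F) _ (d0 P).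
have spanB : Span iota (surface_rank iota F) = setT.
  by rewrite /surface_rank /min_card; case: cid2.
apply: card_le_trans (card_image_le d _).
apply/dimension_reduction_mod_le/subgroup_generated_val.
by rewrite image_comp -(gen _ spanB).
Qed.
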